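(* Let $\sigma \ge 2$ be an integer and let $A$ be an alphabet of size $\sigma$. Define $\xi(2) = 8$ and $\xi(\sigma) = \frac{2\sigma^3 - 2\sigma^2}{(\sigma-2)(\sigma^2-2\sigma+2)}$ for $\sigma > 2$. Then the expected length of the maximal unbordered factor of a uniformly random string of length $n$ over $A$ is at least $$n\cdot\bigl(1 - \xi(\sigma)\cdot\sigma^{-4}\bigr) + \mathcal{O}(1);$$ that is, for each $\sigma \ge 2$ there is a constant $C$ (independent of $n$) such that for all $n \ge 1$, $$\frac{1}{\sigma^n}\sum_{S\in A^n} b(S) \;\ge\; n\cdot\bigl(1-\xi(\sigma)\cdot\sigma^{-4}\bigr) - C .$$
   Context: $A^n$ is the set of all strings of length $n$ over the finite alphabet $A$, and expectations are taken with respect to the uniform distribution on $A^n$. A factor of a string $S=S[1]\cdots S[n]$ is a contiguous substring $S[i..j]=S[i]\cdots S[j]$, $1\le i\le j\le n$. A prefix or suffix of $S$ is proper if it is non-empty and different from $S$. A border of a string is a proper prefix of it that is simultaneously a suffix of it. A string is unbordered if it has no border (in particular every string of length 1 is unbordered). The maximal unbordered factor of $S$ is a longest factor of $S$ that is unbordered; $b(S)$ denotes its length. *)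

(* Defs.v *)
From mathcomp Require Import all_boot all_order all_algebra.

Set Implicit Arguments.
Unset Strict Implicit.
Unset Printing Implicit Defensive.

Import Order.TTheory GRing.Theory Num.Theory.

Section Borders.
Variable T : eqType.
Implicit Types s t : seq T.

Definition border t s := [&& t != [::], t != s, prefix t s & suffix t s].

(* A border of s is a prefix take k s with k < size s; see unborderedP. *)
Definition unbordered s :=
  all (fun k => ~~ border (take k s) s) (iota 0 (size s)).

Lemma unborderedP s : reflect (forall t, ~~ border t s) (unbordered s).
Proof.
apply: (iffP allP) => [H t|H k _]; last exact: H.
apply/negP => bts; have /and4P[_ tDs pts _] := bts.
have tE : take (size t) s = t by apply/eqP; rewrite -prefixE.
have lt_ts : size t < size s.
  rewrite ltnNge; apply: contra tDs => le_st.
  by rewrite -tE take_oversize.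
have /H : size t \in iota 0 (size s) by rewrite mem_iota.
by rewrite tE bts.
Qed.

(* Positions are numbered from 0: this is S[i+1..j+1] for 1-based strings. *)
Definition factor s i j := take (j - i).+1 (drop i s).

Definition max_unbordered s : nat :=
  \max_(p : 'I_(size s) * 'I_(size s) |
          (p.1 <= p.2) && unbordered (factor s p.1 p.2))
     size (factor s p.1 p.2).

Lemma max_unbordered_ge s t :
  infix t s -> unbordered t -> size t <= max_unbordered s.
Proof.
case/infixP=> [u [v ->]]; case: t => [//|x t] xtU.
set s' := u ++ _ ++ v.
have lt_i : size u < size s' by rewrite !size_cat /= addnS ltnS leq_addr.
have lt_j : size u + size t < size s'.
  by rewrite !size_cat /= addSn addnS ltnS leq_add2l leq_addr.
have fE : factor s' (size u) (size u + size t) = x :: t.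
  by rewrite /factor drop_size_cat // addKn /= take_size_cat.
have := @leq_bigmax_cond _ (fun p : 'I_(size s') * 'I_(size s') =>
  (p.1 <= p.2) && unbordered (factor s' p.1 p.2))
  (fun p => size (factor s' p.1 p.2)) (Ordinal lt_i, Ordinal lt_j).
by rewrite /= fE; apply; rewrite leq_addr.
Qed.

Lemma max_unbordered_ex s :
  exists t, [/\ infix t s, unbordered t & size t = max_unbordered s].
Proof.
rewrite /max_unbordered; elim/big_ind: _ => [|m n|p /andP[_ pU]].
- by exists [::]; split; rewrite ?infix0s.
- move=> [t [ti tU tm]] [t' [ti' tU' tn]].
  by case: (leqP m n) => _; [exists t' | exists t].
- exists (factor s p.1 p.2); split=> //.
  by apply: infix_trans (prefixW (prefix_take _ _)) (suffixW (suffix_drop _ _)).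
Qed.

End Borders.

Local Open Scope ring_scope.

(* The value for sigma < 2 is irrelevant. *)
Definition xi (R : realFieldType) (sigma : nat) : R :=
  if sigma == 2%N then 8
  else let x : R := sigma%:R in
       (2 * x ^+ 3 - 2 * x ^+ 2) / ((x - 2) * (x ^+ 2 - 2 * x + 2)).

(* Main.v *)
(* The lost length is even o(n) in expectation.  Let a be a letter other than
   the last letter of S, and start the factor at the first of q blocks of
   length m that equals a^m, ending it with S.  A border of length at most m
   would end in a, and if there is a border at all there is one of length k at
   most half; given that the starting point depends only on a short prefix and
   on the last letter, a border of length k > m occurs with probability at most
   sigma^(1-k).  So for m, then q, large, such a factor of length n - O(1) fails
   to be unbordered with probability below xi(sigma) sigma^-4. *)
Require Import Defs.
From mathcomp Require Import all_boot all_order all_algebra zify lra.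
Set Implicit Arguments.
Unset Strict Implicit.
Unset Printing Implicit Defensive.

(** Take the shortest border. If it were longer than half of [s], its two occurrences would overlap,
    and the overlap would be a shorter border. *)
Lemma bordered_half (T : eqType) (x0 : T) (s : seq T) : ~~ unbordered s ->
  exists k, [/\ 0 < k, k.*2 <= size s &
    forall j, j < k -> nth x0 s j = nth x0 s (size s - k + j)].
Proof.
pose P k := (0 < k < size s) && (take k s == drop (size s - k) s).
have nthP k : P k -> forall j, j < k -> nth x0 s j = nth x0 s (size s - k + j).
  by case/andP=> _ /eqP e j jk; rewrite -(nth_take _ jk) e nth_drop.
move=> /allPn[k]; rewrite mem_iota add0n negbK => /andP[_ ks].
case/and4P=> + _ _; rewrite suffixE size_takel 1?ltnW // => k0 /eqP e.
have Pk : exists k, P k.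
  exists k; rewrite /P ks e eqxx !andbT lt0n; apply: contraNneq k0 => ->.
  by rewrite take0.
have [{e k0 ks} k {}Pk min_k] := ex_minnP Pk; have /andP[/andP[k0 ks] _] := Pk.
exists k; split=> //; last exact: nthP.
rewrite leqNgt; apply/negP => lt_sk.
have /min_k : P (k.*2 - size s); last lia.
apply/andP; split; first lia.
have sz : size (take (k.*2 - size s) s) = k.*2 - size s.
  by rewrite size_takel; lia.
apply/eqP/(@eq_from_nth _ x0); first by rewrite size_drop sz; lia.
move=> j; rewrite sz => jk; rewrite nth_take // nth_drop.
(* The border gives [s] the period [size s - k]; the position [j] is shifted by it twice. *)
rewrite (nthP k Pk) ?(nthP k Pk (size s - k + j)); [|lia..].
by congr nth; lia.
Qed.

(** A border of length at most [m] lies inside the initial run, so it ends in [a]; but it also ends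
    in the last letter of [s]. *)
Lemma bordered_after_run (T : eqType) (x0 a : T) m (s : seq T) :
  (forall j, j < m -> nth x0 s j = a) -> last x0 s != a -> ~~ unbordered s ->
  exists k, [/\ m < k, k.*2 <= size s &
    forall j, j < k -> nth x0 s j = nth x0 s (size s - k + j)].
Proof.
move=> run_a last_a /(bordered_half x0)[k [k0 ks e]]; exists k; split=> //.
rewrite ltnNge; apply: contra last_a => km.
rewrite -nth_last -(run_a k.-1); last lia.
by rewrite (e k.-1); [apply/eqP; congr nth; lia|lia].
Qed.

(* Such a string is determined by its first n - k letters and its last one. *)
Lemma card_border_at (A : finType) (x0 : A) (p : seq A -> A -> nat) n t k :
  0 < k -> t <= n - k -> k <= n ->
  #|[set S : n.-tuple A | (p (take t S) (last x0 S) + k.*2 <= n) &&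
      [forall j : 'I_k, nth x0 S (p (take t S) (last x0 S) + j)
        == nth x0 S (n - k + j)]]| <= #|A| ^ (n - k).+1.
Proof.
move=> k0 tn kn; set B := [set _ | _].
pose f (S : n.-tuple A) : (n - k).-tuple A * A :=
  ([tuple nth x0 S i | i < n - k], last x0 S).
have fP S S' : f S = f S' -> last x0 S = last x0 S' /\
    (forall i, i < n - k -> nth x0 S i = nth x0 S' i).
  move=> e; split=> [|i ik]; first exact: (congr1 snd e).
  have := congr1 (fun u => tnth u.1 (Ordinal ik)) e.
  by rewrite !tnth_mktuple.
have finj : {in B &, injective f}.
  move=> S S'; rewrite !inE => /andP[le1 /forallP b1] /andP[le2 /forallP b2].
  case/fP=> el et.
  have etake : take t S = take t S'.
    apply: (@eq_from_nth _ x0); first by rewrite !size_take !size_tuple.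
    move=> i; rewrite size_takel ?size_tuple => [it|]; last lia.
    by rewrite !nth_take // et //; lia.
  apply/val_inj/(@eq_from_nth _ x0); rewrite !size_tuple // => i lt_in.
  have [ik|ki] := ltnP i (n - k); first exact: et.
  (* The start [p] is the same for [S] and [S']. As [p + k.*2 <= n], the letter at [i] is a copy of
     one before position [n - k], where the strings agree. *)
  have jk : i - (n - k) < k by lia.
  have := b1 (Ordinal jk); have := b2 (Ordinal jk) => /=.
  rewrite subnKC // => /eqP <- /eqP <-; rewrite -el -etake et //; lia.
rewrite -(card_in_imset finj); apply: leq_trans (max_card _) _.
by rewrite card_prod card_tuple expnSr.
Qed.

(** Each of the [q] blocks avoids one of the [#|A| ^ m] words; the remaining letters are free. *)
Lemma card_no_run (A : finType) (x0 a : A) m q n : m * q <= n ->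
  #|[set S : n.-tuple A | [forall i : 'I_q,
      ~~ [forall j : 'I_m, nth x0 S (m * i + j) == a]]]|
    <= (#|A| ^ m).-1 ^ q * #|A| ^ (n - m * q).
Proof.
move=> mqn; set B := [set _ | _].
pose f (S : n.-tuple A) :
    {ffun 'I_q -> {ffun 'I_m -> A}} * {ffun 'I_(n - m * q) -> A} :=
  ([ffun i : 'I_q => [ffun j : 'I_m => nth x0 S (m * i + j)]],
   [ffun j : 'I_(n - m * q) => nth x0 S (m * q + j)]).
have finj : injective f.
  move=> S S' [/ffunP e1 /ffunP e2].
  apply/val_inj/(@eq_from_nth _ x0); rewrite !size_tuple // => i lt_in.
  have [iq|qi] := ltnP i (m * q).
    have m0 : 0 < m by lia.
    have iq' : i %/ m < q by rewrite ltn_divLR // mulnC.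
    have im : i %% m < m by rewrite ltn_mod.
    have := e1 (Ordinal iq'); rewrite !ffunE => /ffunP/(_ (Ordinal im)).
    by rewrite !ffunE /= mulnC -divn_eq.
  have lt_i : i - m * q < n - m * q by lia.
  by have := e2 (Ordinal lt_i); rewrite !ffunE /= subnKC.
rewrite -(card_imset _ finj).
pose C := predC1 ([ffun => a] : {ffun 'I_m -> A}).
apply: (@leq_trans
  #|[predX [pred g | g \in ffun_on C] & {ffun 'I_(n - m * q) -> A}]|).
  apply/subset_leq_card/subsetP => _ /imsetP[S SB ->].
  rewrite !inE andbT; apply/ffun_onP => i; rewrite !inE ffunE.
  move: SB; rewrite inE => /forallP/(_ i); apply: contra => /eqP/ffunP e.
  by apply/forallP => j; have := e j; rewrite !ffunE => ->.
rewrite cardX card_ffun card_ord (eq_card (B := ffun_on C)) //.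
by rewrite card_ffun_on cardC1 card_ffun !card_ord.
Qed.

Lemma sum_expn_leq s r : 1 < s -> \sum_(i < r) s ^ i.+1 <= s ^ r.+1.
Proof.
move=> s1; elim: r => [|r IHr]; first by rewrite big_ord0.
rewrite big_ord_recr /= [s ^ r.+2]expnS.
by apply: leq_trans (leq_mul s1 (leqnn _)); rewrite mul2n -addnn leq_add2r.
Qed.

Lemma card_max_unbordered_lt (A : finType) (x0 x1 : A) m q n :
  x0 != x1 -> 0 < n -> m * q * 2 <= n ->
  #|[set S : n.-tuple A | max_unbordered S < n - m * q]|
    <= 2 * ((#|A| ^ m).-1 ^ q * #|A| ^ (n - m * q)) + #|A| ^ (n - m).+1.
Proof.
move=> x01 n0 qn; have A1 : 1 < #|A| by apply/card_gt1P; exists x0, x1.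
(* Only two candidate run letters occur, hence the factor 2 in the bound. *)
pose other c := if c == x0 then x1 else x0.
have otherN c : c != other c.
  by rewrite /other; case: (eqVneq c x0) => [->|].
pose run a (u : seq A) i := [forall j : 'I_m, nth x0 u (m * i + j) == a].
(* If no block is a run, [find] returns [q]; such strings are covered by [NR]. *)
pose p u c := m * find (run (other c) u) (iota 0 q).
pose NR a := [set S : n.-tuple A | [forall i : 'I_q, ~~ run a S i]].
pose B k := [set S : n.-tuple A |
  (p (take (m * q) S) (last x0 S) + k.*2 <= n) &&
  [forall j : 'I_k, nth x0 S (p (take (m * q) S) (last x0 S) + j)
        == nth x0 S (n - k + j)]].
(* The index is [i = n - k], so that the bounds [#|A| ^ i.+1] form a geometric sum. The condition
   [n <= i.*2] says [k.*2 <= n] and ensures [m * q <= n - k]. *)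
have sub : [set S : n.-tuple A | max_unbordered S < n - m * q] \subset
    (NR x0 :|: NR x1) :|: \bigcup_(i < n - m | n <= i.*2) B (n - i).
  apply/subsetP => S; rewrite inE => maxS.
  rewrite in_setU; have [//|SNR /=] := boolP (S \in NR x0 :|: NR x1).
  set a := other (last x0 S).
  have : S \notin NR a.
    apply: contra SNR; rewrite in_setU /a /other.
    by case: eqP => _ ->; rewrite ?orbT.
  rewrite inE negb_forall => /existsP[i]; rewrite negbK => run_i.
  have run_take b : b < q -> run a (take (m * q) S) b = run a S b.
    move=> bq; apply: eq_forallb => j; rewrite nth_take //.
    by have := ltn_ord j; nia.
  have : has (run a (take (m * q) S)) (iota 0 q).
    by apply/hasP; exists (i : nat); rewrite ?mem_iota ?run_take //=.
  move=> hrun; have := nth_find 0 hrun; move: hrun; rewrite has_find size_iota.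
  set b := find _ _ => bq; rewrite nth_iota // add0n run_take // => run_b.
  have pE : p (take (m * q) S) (last x0 S) = m * b by [].
  have bmq : m * b + m <= m * q by rewrite -mulnSr leq_mul2l bq orbT.
  have bU : ~~ unbordered (drop (m * b) S).
    apply: contraL maxS => U; rewrite -leqNgt.
    apply: leq_trans (max_unbordered_ge (suffixW (suffix_drop _ _)) U).
    by rewrite size_drop size_tuple; lia.
  have runE j : j < m -> nth x0 (drop (m * b) S) j = a.
    move=> jm; rewrite nth_drop; apply/eqP.
    exact: (forallP run_b (Ordinal jm)).
  have lastE : last x0 (drop (m * b) S) != a.
    rewrite -nth_last nth_drop size_drop size_tuple.
    have -> : m * b + (n - m * b).-1 = (size S).-1 by rewrite size_tuple; lia.
    by rewrite nth_last.
  have [k [mk ks e]] := bordered_after_run runE lastE bU.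
  rewrite size_drop size_tuple in ks e.
  have k_lt : n - k < n - m by lia.
  apply/bigcupP; exists (Ordinal k_lt); first by rewrite /=; lia.
  rewrite /= subKn; last lia.
  rewrite inE pE; apply/andP; split; first lia.
  apply/forallP => j; have := e j (ltn_ord j); rewrite !nth_drop => ->.
  by apply/eqP; congr nth; lia.
apply: leq_trans (subset_leq_card sub) _.
apply: leq_trans (leq_card_setU _ _) _; apply: leq_add.
  apply: leq_trans (leq_card_setU _ _) _; rewrite mul2n -addnn.
  by apply: leq_add; apply: card_no_run; lia.
apply: leq_trans (sum_expn_leq (n - m) A1).
have cardB (i : 'I_(n - m)) : n <= i.*2 -> #|B (n - i)| <= #|A| ^ i.+1.
  move=> ni; have := ltn_ord i => lt_i.
  have -> : i.+1 = (n - (n - i)).+1 by lia.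
  by apply: card_border_at; lia.
apply: (@leq_trans (\sum_(i < n - m | n <= i.*2) #|B (n - i)|)).
  elim/big_rec2: _ => [|i u U _ le_uU]; first by rewrite cards0.
  by apply: leq_trans (leq_card_setU _ _) _; rewrite leq_add2l.
by rewrite big_mkcond leq_sum // => i _; case: ifP => // /cardB.
Qed.

(** Bernoulli's inequality [(1 + 1/p)^q >= 1 + q/p], cleared of denominators. *)
Lemma expn_bernoulli p q : (p + q) * p ^ q <= p * p.+1 ^ q.
Proof.
elim: q => [|q IHq]; first by rewrite addn0 !expn0.
rewrite [p ^ _]expnSr [p.+1 ^ _]expnSr; nia.
Qed.

Lemma max_unbordered_tail (s N : nat) : 1 < s ->
  exists t, forall A : finType, #|A| = s -> forall n, 0 < n -> t.*2 <= n ->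
    N * #|[set S : n.-tuple A | max_unbordered S < n - t]| <= s ^ n.
Proof.
(* Each source of failure gets probability at most [1/(2N)]: long borders because
   [s ^ (1 - m) = s ^ (- 2N)], and missing runs because [q / p = 4N] in Bernoulli's inequality. *)
move=> s1; set m := N.*2.+1; set p := (s ^ m).-1; set q := 4 * N * p.
exists (m * q) => A cardA n n0 qn.
have /card_gt1P[x0 [x1 [_ _ x01]]] : 1 < #|A| by rewrite cardA.
have p0 : 0 < p.
  by have := ltn_expl m s1; lia.
have pE : p.+1 = s ^ m by rewrite prednK // expn_gt0 ltnW.
have short : 4 * N * p ^ q <= s ^ (m * q).
  rewrite expnM -pE -(leq_pmul2l p0); apply: leq_trans (expn_bernoulli p q).
  by rewrite mulnA [p * _]mulnC leq_mul2r leq_addl orbT.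
(* For [n < m] the subtraction [n - m] truncates; but then [m * q * 2 <= n] forces [q = 0], hence
   [N = 0]. *)
have [nm|mn] := ltnP n m.
  have q0 : q = 0 by nia.
  have -> : N = 0 by move: q0; rewrite /q; nia.
  by rewrite mul0n.
have long : N.*2 * s ^ (n - m).+1 <= s ^ n.
  apply: (@leq_trans (s ^ N.*2 * s ^ (n - m).+1)).
    by rewrite leq_mul2r (ltnW (ltn_expl _ _)) ?orbT.
  by rewrite -expnD leq_exp2l //; lia.
have qn2 : m * q * 2 <= n by lia.
have := card_max_unbordered_lt x01 n0 qn2.
rewrite cardA -/p => card_le.
have split_n : s ^ (m * q) * s ^ (n - m * q) = s ^ n.
  by rewrite -expnD subnKC //; lia.
have {}short := leq_mul short (leqnn (s ^ (n - m * q))).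
rewrite split_n in short.
move: card_le short long; set c := #|_|.
move: (p ^ q) (s ^ (n - m * q)) (s ^ (n - m).+1) (s ^ n) => a b d e.
by move=> /(leq_mul (leqnn N.*2)); nia.
Qed.

Import Order.TTheory GRing.Theory Num.Theory.
Local Open Scope ring_scope.

(** Positivity of the loss rate is what allows an [N] above its inverse to be chosen. For
    [sigma > 2] the quadratic factor is [(x - 1)^2 + 1]. *)
Lemma xi_gt0 (R : realFieldType) (sigma : nat) :
  (1 < sigma)%N -> 0 < xi R sigma.
Proof.
move=> s1; rewrite /xi; case: eqP => [_|/eqP s2]; first by rewrite ltr0n.
have s3 : (2 < sigma)%N by rewrite ltn_neqAle eq_sym s2.
have : 2 < sigma%:R :> R by rewrite ltr_nat.
move: (sigma%:R : R) => x x2.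
by apply: divr_gt0; [|apply: mulr_gt0]; nra.
Qed.

Theorem theorem2 (R : archiRealFieldType) (sigma : nat)
    (hsigma : (2 <= sigma)%N) :
  exists C : R, forall A : finType, #|A| = sigma ->
    forall n : nat, (1 <= n)%N ->
      (sigma%:R ^+ n)^-1 * (\sum_(S : n.-tuple A) (max_unbordered S)%:R)
        >= n%:R * (1 - xi R sigma * sigma%:R ^- 4) - C.
Proof.
have s0 : 0 < sigma%:R :> R by rewrite ltr0n ltnW.
set e := xi R sigma * _; have e0 : 0 < e.
  by rewrite mulr_gt0 ?xi_gt0 // invr_gt0 exprn_gt0.
pose N := Num.bound e^-1.
have N_gt : e^-1 < N%:R by apply: archi_boundP; rewrite invr_ge0 ltW.
have N0 : 0 < N%:R :> R by apply: lt_trans N_gt; rewrite invr_gt0.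
have [t tP] := max_unbordered_tail N hsigma.
(* For [n < 2t] this constant makes the lower bound nonpositive; for larger [n] it absorbs the loss
   of [t]. *)
exists t.*2%:R => A cardA n n0.
have sn0 : 0 < sigma%:R ^+ n :> R by rewrite exprn_gt0.
have [nt|tn] := ltnP n t.*2.
  apply: (@le_trans _ _ 0); last first.
    by rewrite mulr_ge0 ?invr_ge0 ?(ltW sn0) // sumr_ge0.
  have : n%:R <= t.*2%:R :> R by rewrite ler_nat ltnW.
  have : 0 <= n%:R :> R by [].
  by nra.
set bad := [set S : n.-tuple A | (max_unbordered S < n - t)%N].
have bad_le : #|bad|%:R <= e * sigma%:R ^+ n.
  have : (N * #|bad|)%:R <= sigma%:R ^+ n :> R by rewrite -natrX ler_nat tP.
  rewrite natrM => le_bad; have : 1 <= e * N%:R.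
    by rewrite -ler_pdivrMl // mulr1 ltW.
  have : 0 <= #|bad|%:R :> R by [].
  by nra.
(* A good string contributes at least [n - t], a bad one at least [0 >= (n - t) - n]. *)
have sum_ge : (n%:R - t%:R) * sigma%:R ^+ n - n%:R * #|bad|%:R
    <= \sum_(S : n.-tuple A) (max_unbordered S)%:R :> R.
  have -> : (n%:R - t%:R) * sigma%:R ^+ n - n%:R * #|bad|%:R =
      \sum_(S : n.-tuple A) (n%:R - t%:R - n%:R * (S \in bad)%:R) :> R.
    rewrite big_split /= sumr_const card_tuple cardA -natrX mulr_natr.
    congr (_ + _); rewrite sumrN -mulr_sumr -natr_sum.
    by rewrite -sum1_card big_mkcond.
  apply: ler_sum => S _; rewrite inE.
  case: ltnP => [_|].
    by rewrite mulr1 addrAC subrr sub0r (le_trans _ (ler0n _ _)) // oppr_le0.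
  rewrite mulr0 subr0 -natrB; last lia.
  by rewrite ler_nat.
rewrite [leRHS]mulrC ler_pdivlMr //; apply: le_trans sum_ge.
have : 0 <= t%:R :> R by [].
have : 0 <= n%:R :> R by [].
rewrite -muln2 natrM; nra.
Qed.
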